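(* As $n\to\infty$ through the positive integers, $$\gamma = \frac{A_n-L_n}{\binom{2n}{n}} + O\left(2^{-6n}n^{-1/2}\right).$$
   Context: Here $\log$ is the natural logarithm. $H_N=\sum_{k=1}^N k^{-1}$ is the $N$th harmonic number, and Euler's constant is $\gamma := \lim_{N\to\infty}(H_N-\log N)$. For each positive integer $n$, $$A_n := \sum_{i=0}^n\binom{n}{i}^2H_{n+i},\qquad L_n := \sum_{k=1}^{n}\ \sum_{i=0}^{\min(k-1,\,n-k)}\ \sum_{j=i+1}^{n-i}\binom{n}{i}^2\frac{2}{j}\log(n+k).$$ *)

(* Defs.v *)
(* MathComp-Analysis, over an arbitrary [R : realType]. *)
From mathcomp Require Import all_boot all_order all_algebra.
From mathcomp Require Import all_classical all_reals all_analysis.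

Set Implicit Arguments.
Unset Strict Implicit.
Unset Printing Implicit Defensive.

Import Order.TTheory GRing.Theory Num.Theory.
Import numFieldNormedType.Exports.

Local Open Scope classical_set_scope.
Local Open Scope ring_scope.

(* The library's [harmonic] is the sequence of the terms 1/(k+1), not of their
   partial sums. *)
Definition harmonic_number (R : realType) (N : nat) : R :=
  \sum_(1 <= k < N.+1) k%:R^-1.

Definition euler_gamma (R : realType) : R :=
  lim ((fun N : nat => harmonic_number R N - ln N%:R) @ \oo).

Definition A_ (R : realType) (n : nat) : R :=
  \sum_(0 <= i < n.+1) ('C(n, i) ^ 2)%:R * harmonic_number R (n + i).

(* The ranges make the truncated subtractions exact: 1 <= k <= n and, in the
   innermost sum, i <= n. *)
Definition L_ (R : realType) (n : nat) : R :=
  \sum_(1 <= k < n.+1)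
    \sum_(0 <= i < (minn (k - 1) (n - k)).+1)
      \sum_(i.+1 <= j < (n - i).+1)
        ('C(n, i) ^ 2)%:R * (2 / j%:R) * ln (n + k)%:R.

(* Main.v *)
Require Import Defs.
From mathcomp Require Import all_boot all_order all_algebra.
From mathcomp Require Import all_classical all_reals all_analysis.
From mathcomp Require Import ring lra zify.
Import Order.TTheory GRing.Theory Num.Theory.
Import numFieldNormedType.Exports.
Local Open Scope classical_set_scope.
Local Open Scope ring_scope.

Set Implicit Arguments.
Unset Strict Implicit.
Unset Printing Implicit Defensive.

(** Let B(x) = n! / (x (x+1) ... (x+n)).  The square of B has double poles at
    0, -1, ..., -n, with partial fractions
      B(x)^2 = sum_k  'C(n,k)^2 / (x+k)^2  -  D_k / (x+k),
      D_k = 2 'C(n,k)^2 (H_(n-k) - H_k)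
    ([kernel_sqr]).  Hence
      T(x) = sum_k  'C(n,k)^2 / (x+k) + D_k log(x+k)
    is an antiderivative of - B^2.  As D_(n-k) = - D_k, the D_k add up to 0, so T
    vanishes at infinity: T(x) is the integral of B^2 over [x, +oo).

    Consider the series of the T(v), v >= n+1 (Sondow's series).  Summing up
    to v = n+M, the terms 'C(n,k)^2 / (v+k) give harmonic numbers and the terms
    D_k log(v+k) give logarithms of factorials.  The divergent parts cancel
    for large M, because
      sum_k 'C(n,k)^2 = 'C(2n,n),  sum_k D_k = 0,  sum_k k D_k = - 'C(2n,n)
    ([sum_sqbin], [sum_logcoef], [sum_mul_logcoef]): the last identity
    says that B(x)^2 has no term in x^(-2) at infinity.  What is left is
      sum_(v > n) T(v) = 'C(2n,n) gamma + L_n - A_n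
    ([cvg_sum_kernel_tail]), where L_n appears through an Abel summation and
    the antisymmetry of D ([L_E]).

    It remains to see that this series is small.  By the mean value theorem
    0 <= T(v) - T(v+1) <= B(v)^2, and B(n+1+k) / B(n+1) is at most
    6 / ((k+2)(k+3)), so that two telescoping comparisons bound the series by
    6 B(n+1)^2 ([sum_kernel_tail_bounds]).  As B(n+1) = 1 / ((2n+1) 'C(2n,n)),
    after division by 'C(2n,n) the error is at most
    6 / ((2n+1)^2 'C(2n,n)^3), and 'C(2n,n) >= 4^n / (2 sqrt n) turns this into
    12 * 2^(-6n) n^(-1/2). *)

(** * Elementary sums and central binomial coefficients *)

Lemma abel_summation (R : comNzRingType) (d l : nat -> R) (n : nat) :
  \sum_(k < n.+1) d k * (\sum_(m < k) l m) +
  \sum_(m < n) (\sum_(i < m.+1) d i) * l m =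
  (\sum_(i < n.+1) d i) * (\sum_(m < n) l m).
Proof.
elim: n => [|n IH]; first by rewrite !big_ord1 !big_ord0 addr0 !mulr0.
have eT : \sum_(m < n.+1) l m = \sum_(m < n) l m + l n by rewrite big_ord_recr.
have eD : \sum_(i < n.+2) d i = \sum_(i < n.+1) d i + d n.+1 by rewrite big_ord_recr.
rewrite [X in X + _]big_ord_recr/= [X in _ + X]big_ord_recr/= addrACA IH eD !eT.
ring.
Qed.

Lemma central_binomialS n :
  (n.+1 * 'C(2 * n.+1, n.+1) = 2 * (2 * n).+1 * 'C(2 * n, n))%N.
Proof.
apply/eqP; rewrite -(eqn_pmul2l (ltn0Sn n)); apply/eqP.
have e1 := mul_bin_diag (2 * n.+1) n.
have := mul_bin_down (2 * n).+1 n.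
rewrite mulnS in e1 *; rewrite /= in e1 *.
have -> : ((2 * n).+1 - n = n.+1)%N by lia.
move: ('C(_, _)) ('C(_, _)) ('C(_, _)) e1; nia.
Qed.

(** The squared form of 'C(2n,n) >= 4^n / (2 sqrt n); squaring keeps the
    induction within the natural numbers. *)
Lemma central_binomial_lb n : (0 < n)%N ->
  (16 ^ n <= 4 * n * 'C(2 * n, n) ^ 2)%N.
Proof.
elim: n => // -[|n] IH _; first by [].
have := IH isT; have := central_binomialS n.+1; rewrite (expnS 16 n.+1).
move: 'C(2 * n.+2, n.+2) 'C(2 * n.+1, n.+1) (16 ^ n.+1)%N => a b c e h.
rewrite -(leq_pmul2l (ltn0Sn n.+1)).
have -> : (n.+2 * (4 * n.+2 * a ^ 2) = 4 * (n.+2 * a) ^ 2)%N by ring.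
rewrite e; apply: (@leq_trans (n.+2 * (16 * (4 * n.+1 * b ^ 2)))).
  by rewrite !leq_mul2l h !orbT.
rewrite expnMn; move: (b ^ 2)%N => B.
rewrite (_ : _ * (16 * _) = 64 * (n.+1 * n.+2) * B)%N; last by ring.
by rewrite (mulnA 4) leq_mul2r; apply/orP; right; nia.
Qed.

(** * Partial fractions of the squared kernel *)

Section SondowSeries.
Variable R : realType.
Implicit Types (x y : R) (n k : nat).

Local Notation H := (harmonic_number R).
Local Notation sqbin n k := (('C(n, k) ^ 2)%:R : R).

Lemma harmonic_numberS n : H n.+1 = H n + n.+1%:R^-1.
Proof. by rewrite /harmonic_number big_nat_recr. Qed.

(** For x > 0 this is the Beta integral of t^(x-1) (1-t)^n over [0, 1]. *)
Definition kernel n x : R := n`!%:R / \prod_(k < n.+1) (x + k%:R).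

(** The opposite of the residue of the squared kernel at -k, which makes it
    the coefficient of ln (x + k) in [kernel_tail]. *)
Definition logcoef n k : R := 2 * sqbin n k * (H (n - k) - H k).

Lemma logcoef_rev n k : (k <= n)%N -> logcoef n (n - k) = - logcoef n k.
Proof.
move=> kn; rewrite /logcoef bin_sub// subKn//; ring.
Qed.

Lemma sum_logcoef n : \sum_(k < n.+1) logcoef n k = 0.
Proof.
have : \sum_(k < n.+1) logcoef n k = - \sum_(k < n.+1) logcoef n k.
  rewrite {1}(reindex_inj rev_ord_inj)/= -sumrN; apply: eq_bigr => k _.
  by rewrite subSS logcoef_rev// -ltnS.
lra.
Qed.

Lemma logcoef_last n :
  logcoef n.+1 n.+1 = - \sum_(k < n.+1) logcoef n.+1 k.
Proof.
have /eqP := sum_logcoef n.+1.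
by rewrite big_ord_recr/= addrC addr_eq0 => /eqP.
Qed.

Lemma sqbinS n k : (k <= n)%N ->
  sqbin n.+1 k = sqbin n k * (n.+1%:R / (n.+1 - k)%:R) ^+ 2.
Proof.
move=> kn; have d0 : (n.+1 - k)%:R != 0 :> R by rewrite pnatr_eq0; lia.
have /(congr1 (fun m => m%:R : R)) := mul_bin_down n.+1 k.
rewrite /= !natrM => e.
have -> : ('C(n.+1, k)%:R : R) = 'C(n, k)%:R * (n.+1%:R / (n.+1 - k)%:R).
  by apply: (mulfI d0); rewrite -e; field.
ring.
Qed.

Lemma logcoefS n k : (k <= n)%N -> logcoef n.+1 k =
  (n.+1%:R / (n.+1 - k)%:R) ^+ 2 *
    (logcoef n k + 2 * sqbin n k / (n.+1 - k)%:R).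
Proof.
move=> kn; rewrite /logcoef sqbinS// subSn// harmonic_numberS -subSn//.
have d0 : (n.+1 - k)%:R != 0 :> R by rewrite pnatr_eq0; lia.
ring.
Qed.

Lemma kernelS n x : kernel n.+1 x = kernel n x * n.+1%:R / (x + n.+1%:R).
Proof.
rewrite /kernel big_ord_recr/= factS natrM invfM; ring.
Qed.

(** Multiplied by (n+1)^2, this is the coefficient of the new double pole in
    the induction step of [kernel_sqr]. *)
Lemma kernel_sqrN n : kernel n (- n.+1%:R) ^+ 2 = n.+1%:R ^- 2.
Proof.
rewrite /kernel.
have -> : \prod_(k < n.+1) (- n.+1%:R + k%:R) = (-1) ^+ n.+1 * n.+1`!%:R :> R.
  rewrite (reindex_inj rev_ord_inj)/= fact_prod.
  have -> : (-1) ^+ n.+1 = (-1) ^+ #|'I_n.+1| :> R by rewrite card_ord.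
  rewrite big_add1/= big_mkord natr_prod -prodrN.
  apply: eq_bigr => k _; have kn : (k <= n)%N by rewrite -ltnS.
  rewrite subSS natrB // -[n.+1%:R]natr1 -[k.+1%:R]natr1.
  by move: (n%:R) (k%:R) => a b; ring.
rewrite expr_div_n exprMn sqrr_sign mul1r factS natrM.
have f0 : n`!%:R != 0 :> R by rewrite pnatr_eq0 -lt0n fact_gt0.
have d0 : n.+1%:R != 0 :> R by rewrite pnatr_eq0.
by move: f0 d0; move: (n`!%:R) (n.+1%:R) => f d f0 d0; field; rewrite d0 f0.
Qed.

(** By induction on n, since [kernel n.+1 x] is [kernel n x] times
    (n+1) / (x+n+1).  Each old term 1 / (x+k)^2 or 1 / (x+k), multiplied by
    1 / (x+n+1)^2, splits into fractions with poles at -k and -(n+1); the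
    coefficients at -k follow the recurrences [sqbinS] and [logcoefS].  At the
    new pole, the coefficient of 1 / (x+n+1)^2 is the value of the induction
    hypothesis at -(n+1), and that of 1 / (x+n+1) is forced because every split
    keeps the sum of the residues equal to 0. *)
Lemma kernel_sqr n x : (forall k, (k <= n)%N -> x + k%:R != 0) ->
  kernel n x ^+ 2 =
    \sum_(k < n.+1) (sqbin n k / (x + k%:R) ^+ 2 - logcoef n k / (x + k%:R)).
Proof.
elim: n x => [|n IH] x xk.
  rewrite /kernel /logcoef !big_ord1 /= bin0 subrr addr0 expr_div_n.
  rewrite fact0 exp1n; ring.
rewrite kernelS.
have x0 : x + n.+1%:R != 0 by exact: xk.
have S0 : n.+1%:R != 0 :> R by rewrite pnatr_eq0.
have IHx := IH x (fun k kn => xk k (leqW kn)).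
have IHN := IH (- n.+1%:R).
rewrite big_ord_recr/= binn exp1n logcoef_last.
have e1 : n.+1%:R ^+ 2 * \sum_(k < n.+1) (sqbin n k / (- n.+1%:R + k%:R) ^+ 2
        - logcoef n k / (- n.+1%:R + k%:R)) = 1.
  rewrite -IHN ?kernel_sqrN ?divff ?expf_neq0// => k kn.
  by rewrite addrC subr_eq0 eqr_nat; lia.
(* The coefficient 1 of the new double pole is replaced by a sum over the old
   poles, so that the identity can be checked term by term. *)
rewrite -[1%:R]e1 -mulrA exprMn IHx.
rewrite mulr_suml mulr_sumr mulr_suml mulNr opprK mulr_suml -!big_split/=.
apply: eq_bigr => k _; have kn : (k <= n)%N by rewrite -ltnS.
rewrite sqbinS// logcoefS// natrB ?leqW//.
have d0 : n.+1%:R - k%:R != 0 :> R by rewrite subr_eq0 eqr_nat; lia.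
have k0 := xk k (leqW kn).
have d0' : - n.+1%:R + k%:R != 0 :> R by rewrite addrC -opprB oppr_eq0.
move: (n.+1%:R) x0 d0 d0' k0 => N x0 d0 d0' k0.
by field; rewrite x0 d0 d0'.
Qed.

Lemma sum_sqbin n : \sum_(k < n.+1) sqbin n k = 'C(2 * n, n)%:R.
Proof.
rewrite mul2n -addnn -binomial.Vandermonde natr_sum; apply: eq_bigr => k _.
by rewrite bin_sub ?mulnn// -ltnS.
Qed.

(** This expresses that the coefficient of x^(-2) in the expansion of the
    squared kernel at infinity vanishes.  Writing n = m+1 and using
    [logcoef_last] to trade the last term for the others, the identity reduces
    to the partial fractions of order m evaluated at -(m+1). *)
Lemma sum_mul_logcoef n : (0 < n)%N ->
  \sum_(k < n.+1) k%:R * logcoef n k = - 'C(2 * n, n)%:R.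
Proof.
case: n => // n _; apply/eqP; rewrite -addr_eq0 -sum_sqbin -big_split/=.
have S0 : n.+1%:R != 0 :> R by rewrite pnatr_eq0.
have e1 : n.+1%:R ^+ 2 * \sum_(k < n.+1) (sqbin n k / (- n.+1%:R + k%:R) ^+ 2
        - logcoef n k / (- n.+1%:R + k%:R)) = 1.
  rewrite -kernel_sqr ?kernel_sqrN ?divff ?expf_neq0// => k kn.
  by rewrite addrC subr_eq0 eqr_nat; lia.
rewrite big_ord_recr/= logcoef_last binn exp1n -[1%:R]e1 !mulrN.
rewrite mulr_sumr -sumrN mulr_sumr -!big_split/=.
apply/eqP/big1 => k _; have kn : (k <= n)%N by rewrite -ltnS.
rewrite sqbinS// logcoefS// natrB ?leqW//.
have d0 : n.+1%:R - k%:R != 0 :> R by rewrite subr_eq0 eqr_nat; lia.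
have d0' : - n.+1%:R + k%:R != 0 :> R by rewrite addrC -opprB oppr_eq0.
move: (n.+1%:R) d0 d0' => N d0 d0'.
by field; rewrite d0 d0'.
Qed.

(** * The kernel and the tail of its square *)

Lemma kernel_gt0 n x : 0 < x -> 0 < kernel n x.
Proof.
move=> x0; rewrite /kernel divr_gt0 ?ltr0n ?fact_gt0// prodr_gt0// => k _.
by rewrite ltr_wpDr.
Qed.

Lemma kernel_nonincreasing n x y : 0 < x -> x <= y -> kernel n y <= kernel n x.
Proof.
move=> x0 xy; rewrite /kernel ler_wpM2l// lef_pV2 ?posrE ?prodr_gt0// => [|k _|k _].
- by apply: ler_prod => k _; rewrite lerD2r xy addr_ge0// ltW.
- by rewrite ltr_wpDr// (lt_le_trans x0).
- by rewrite ltr_wpDr.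
Qed.

(** The products at x and x+1 share all factors but x and x+n+1. *)
Lemma kernelD1 n x : 0 < x -> kernel n (x + 1) = kernel n x * (x / (x + n.+1%:R)).
Proof.
move=> x0; rewrite /kernel.
have pos k : x + k%:R != 0 by rewrite gt_eqF// ltr_wpDr.
have e : x * \prod_(k < n.+1) (x + 1 + k%:R) =
    \prod_(k < n.+1) (x + k%:R) * (x + n.+1%:R).
  transitivity (\prod_(k < n.+2) (x + k%:R)); last by rewrite big_ord_recr.
  rewrite [RHS]big_ord_recl/= addr0.
  by congr (_ * _); apply: eq_bigr => k _; rewrite -addrA nat1r.
have p0 : \prod_(k < n.+1) (x + k%:R) != 0 by apply/prodf_neq0 => k _.
have p1 : \prod_(k < n.+1) (x + 1 + k%:R) != 0.
  by apply/prodf_neq0 => k _; rewrite -addrA nat1r.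
have xn := pos n.+1; have {}x0 : x != 0 by rewrite gt_eqF.
set a := \prod_(k < n.+1) (x + k%:R) in p0 e *.
set b := \prod_(k < n.+1) (x + 1 + k%:R) in p1 e *.
move: (x + n.+1%:R) xn e => c c0 e; apply: (mulIf p1); rewrite mulfVK//.
apply: (mulIf p0); apply: (mulIf c0).
have -> : n`!%:R / a * (x / c) * b * a * c = n`!%:R * (x * b) :> R.
  by field; rewrite p0 c0.
by rewrite e mulrA.
Qed.

(** By [kernelD1] the step from n+1+k to n+2+k multiplies the kernel by
    (n+1+k) / (2n+2+k).  For n >= 1 this is at most (2+k) / (4+k), its value at
    n = 1, and the product of the latter telescopes.  The bound is thus uniform
    in n, with a square that is summable twice. *)
Lemma kernel_decay n k : (0 < n)%N ->
  kernel n (n.+1 + k)%:R <= kernel n n.+1%:R * (6 / ((k + 2) * (k + 3))%:R) :> R.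
Proof.
move=> n0; elim: k => [|k IH].
  by rewrite addn0 divff ?mulr1.
rewrite addnS -natr1 kernelD1 ?ltr0n//.
apply: (le_trans (ler_wpM2r _ IH)); first by rewrite divr_ge0// addr_ge0.
have K0 := @kernel_gt0 n n.+1%:R (ltr0Sn _ _).
rewrite -mulrA ler_pM2l//.
have e : (n.+1 + k)%:R / ((n.+1 + k)%:R + n.+1%:R) <= (k + 2)%:R / (k + 4)%:R :> R.
  rewrite -natrD ler_pdivrMr ?ltr0n ?addn_gt0// mulrAC ler_pdivlMr ?ltr0n ?addn_gt0//.
    rewrite -!natrM ler_nat; nia.
  by rewrite orbT.
apply: (le_trans (ler_wpM2l _ e)); first by rewrite divr_ge0.
rewrite le_eqVlt; apply/orP; left; apply/eqP.
rewrite !natrM !natrD -[k.+1%:R]natr1.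
have k0 : 0 <= k%:R :> R by [].
by field; rewrite !gt_eqF//; lra.
Qed.

(** For x > 0 this is the integral of the squared kernel over [x, +oo), in
    closed form. *)
Definition kernel_tail n x : R :=
  \sum_(k < n.+1) (sqbin n k / (x + k%:R) + logcoef n k * ln (x + k%:R)).

Lemma is_derive_kernel_tail n x : 0 < x ->
  is_derive x 1 (kernel_tail n) (- kernel n x ^+ 2).
Proof.
move=> x0.
have pos k : 0 < x + k%:R by rewrite ltr_wpDr.
have -> : kernel_tail n = \sum_(k < n.+1) ((sqbin n k \*: (fun x => (x + k%:R)^-1))
    + (logcoef n k \*: (@ln R \o (fun x => x + k%:R)))).
  by apply/funext => y; rewrite fct_sumE; apply: eq_bigr => k _.
rewrite kernel_sqr => [|k _]; last by rewrite gt_eqF.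
rewrite -sumrN; apply: is_derive_sum => k.
have dk : is_derive x 1 (fun x : R => x + k%:R) (1 : R).
  by apply: is_derive_eq; rewrite ?addr0.
have dl : is_derive x 1 ((@ln R) \o (fun x : R => x + k%:R)) ((x + k%:R)^-1 * 1).
  apply: is_derive1_comp; exact: is_derive1_ln.
have dV : is_derive x 1 (fun x : R => (x + k%:R)^-1) (- (x + k%:R) ^- 2 *: 1).
  by apply: is_deriveV; rewrite // gt_eqF.
apply: is_derive_eq; rewrite /GRing.scale/= !mulr1.
ring.
Qed.

Lemma kernel_tail_step n x : 0 < x ->
  0 <= kernel_tail n x - kernel_tail n (x + 1) <= kernel n x ^+ 2.
Proof.
move=> x0; have x1 : x < x + 1 by rewrite ltrDl.
have d y : y \in `]x, (x + 1)[ -> is_derive y 1 (kernel_tail n) (- kernel n y ^+ 2).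
  rewrite in_itv/= => /andP[xy _]; apply: is_derive_kernel_tail.
  exact: lt_trans xy.
have c : {within `[x, x + 1], continuous (kernel_tail n)}.
  apply: derivable_within_continuous => y; rewrite in_itv/= => /andP[xy _].
  by have [] := is_derive_kernel_tail n (lt_le_trans x0 xy).
have [y] := MVT x1 d c.
rewrite in_itv/= => /andP[xy _] e.
have -> : kernel_tail n x - kernel_tail n (x + 1) = kernel n y ^+ 2.
  by rewrite -opprB e addrAC subrr add0r mulr1 opprK.
rewrite sqr_ge0/= ler_sqr ?nnegrE; first exact: kernel_nonincreasing (ltW xy).
  by apply/ltW/kernel_gt0/(lt_trans x0).
exact/ltW/kernel_gt0.
Qed.

Lemma cvg_ln_shift k :
  (fun N : nat => ln (N + k)%:R - ln N%:R : R) @ \oo --> (0 : R).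
Proof.
rewrite -(cvg_shiftn 1)/=.
have h0 : (fun N : nat => k%:R * harmonic N : R) @ \oo --> (0 : R).
  rewrite -[X in _ --> X](mulr0 k%:R); apply: cvgMl_tmp; exact: cvg_harmonic.
apply: squeeze_cvgr h0; last exact: (cvg_cst (0:R)).
near=> N; rewrite addn1.
have N0 : 0 < N.+1%:R :> R by [].
have Nk : 0 < (N.+1 + k)%:R :> R by rewrite ltr0n.
rewrite -ln_div// natrD mulrDl divff ?gt_eqF//.
have hk : 0 <= k%:R / N.+1%:R :> R by rewrite divr_ge0.
rewrite ln_ge0 ?lerDl//= /harmonic/=.
by apply: le_ln1Dx; apply: lt_le_trans hk; rewrite ltrN10.
Unshelve. all: by end_near. Qed.

(** As the [logcoef n k] add up to 0, ln N can be subtracted from every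
    logarithm. *)
Lemma cvg_kernel_tail n :
  (fun N : nat => kernel_tail n N%:R) @ \oo --> (0 : R).
Proof.
have -> : (fun N : nat => kernel_tail n N%:R) = fun N : nat => \sum_(k < n.+1)
    (sqbin n k / (N%:R + k%:R) + logcoef n k * (ln (N + k)%:R - ln N%:R)).
  apply/funext => N; under [RHS]eq_bigr do rewrite mulrBr addrA -natrD.
  rewrite [RHS]big_split/= sumrN -mulr_suml sum_logcoef mul0r subr0.
  by apply: eq_bigr => k _; rewrite natrD.
rewrite [X in _ --> X](_ : 0 = \sum_(k < n.+1) (0 : R)); last by rewrite big1.
apply: cvg_big => [|k _]; first exact: add_continuous.
rewrite -[X in _ --> X](addr0 0); apply: cvgD; last first.
  rewrite -[X in _ --> X](mulr0 (logcoef n k)); apply: cvgMl_tmp.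
  exact: cvg_ln_shift.
rewrite -[X in _ --> X](mulr0 (sqbin n k)); apply: cvgMl_tmp.
rewrite -(cvg_shiftn 1)/=.
apply: squeeze_cvgr (@cvg_harmonic R); last exact: (cvg_cst (0:R)).
near=> N; rewrite addn1 invr_ge0 addr_ge0//= /harmonic/=.
by rewrite lef_pV2 ?posrE ?lerDl ?ltr_wpDr.
Unshelve. all: by end_near. Qed.

(** Both bounds compare sequences with limit 0 through their increments
    ([kernel_tail_step]): such a sequence is nonnegative as soon as it is
    nonincreasing.  The comparison sequence 6 / ((k+1)(k+2)) is chosen so that
    its decrements dominate the squares of the bounds in [kernel_decay]. *)
Lemma kernel_tail_bounds n k : (0 < n)%N ->
  0 <= kernel_tail n (n.+1 + k)%:R <=
    kernel n n.+1%:R ^+ 2 * (6 / ((k + 1) * (k + 2))%:R).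
Proof.
move=> n0; set K := kernel n n.+1%:R : R.
pose F k := kernel_tail n (n.+1 + k)%:R.
pose G k : R := K ^+ 2 * (6 / ((k + 1) * (k + 2))%:R).
have F0 : F @ \oo --> (0 : R).
  have -> : F = (fun k => kernel_tail n (k + n.+1)%:R).
    by apply/funext => k'; rewrite /F addnC.
  by have := cvg_kernel_tail n; rewrite -(cvg_shiftn n.+1).
have G0 : G @ \oo --> (0 : R).
  have h0 : (fun N : nat => K ^+ 2 * 6 * harmonic N : R) @ \oo --> (0 : R).
    rewrite -[X in _ --> X](mulr0 (K ^+ 2 * 6)); apply: cvgMl_tmp; exact: cvg_harmonic.
  apply: squeeze_cvgr h0; last exact: (cvg_cst (0:R)).
  near=> N; apply/andP; split; first by rewrite mulr_ge0 ?sqr_ge0// divr_ge0.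
  rewrite /G /harmonic/= -mulrA ler_wpM2l ?sqr_ge0// ler_wpM2l//.
  rewrite lef_pV2 ?posrE ?ltr0n ?ler_nat; nia.
have step j : 0 <= F j - F j.+1 <= G j - G j.+1.
  have /andP[l u] := kernel_tail_step n (ltr0Sn R (n + j)).
  have -> : F j.+1 = kernel_tail n ((n + j).+1%:R + 1) by rewrite /F addnS natr1.
  rewrite -[F j]/(kernel_tail n (n + j).+1%:R) l/=.
  apply: (le_trans u).
  have d := kernel_decay j n0.
  have : kernel n (n.+1 + j)%:R ^+ 2 <= (K * (6 / ((j + 2) * (j + 3))%:R)) ^+ 2 :> R.
    have K0 : 0 < K by exact: kernel_gt0.
    have k0 : 0 < kernel n (n + j).+1%:R :> R by exact: kernel_gt0.
    by apply: lerXn2r d; rewrite nnegrE ltW//;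
      rewrite mulr_gt0// divr_gt0// ltr0n muln_gt0 !addn_gt0 !orbT.
  move/le_trans; apply; rewrite exprMn /G -mulrBr ler_wpM2l ?sqr_ge0//.
  have j0 : 0 <= j%:R :> R by [].
  rewrite !natrM !natrD -[j.+1%:R]natr1 -subr_ge0.
  have -> : 6 / ((j%:R + 1) * (j%:R + 2)) - 6 / ((j%:R + 1 + 1) * (j%:R + 1 + 2))
     - (6 / ((j%:R + 2) * (j%:R + 3))) ^+ 2 =
     12 * (j%:R ^+ 2 + 2 * j%:R + 3) / ((j%:R + 1) * (j%:R + 2) ^+ 2 * (j%:R + 3) ^+ 2) :> R.
    by field; rewrite !gt_eqF//; lra.
  by rewrite divr_ge0 ?mulr_ge0 ?addr_ge0 ?exprn_ge0.
apply/andP; split.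
  rewrite -(cvg_lim (@norm_hausdorff _ _) F0).
  apply: (@nonincreasing_cvgn_ge _ F); last by apply/cvg_ex; exists 0.
  by apply/nonincreasing_seqP => j; have /andP[+ _] := step j; rewrite subr_ge0.
rewrite -subr_ge0.
have GF : (fun j => G j - F j) @ \oo --> (0 : R).
  by rewrite -[X in _ --> X](subr0 0); apply: cvgB.
rewrite -(cvg_lim (@norm_hausdorff _ _) GF).
apply: (@nonincreasing_cvgn_ge _ (fun j => G j - F j)); last by apply/cvg_ex; exists 0.
apply/nonincreasing_seqP => j; have /andP[_] := step j; lra.
Unshelve. all: by end_near. Qed.

Lemma sum_kernel_tail_bounds n M : (0 < n)%N ->
  0 <= \sum_(k < M) kernel_tail n (n.+1 + k)%:R <= 6 * kernel n n.+1%:R ^+ 2.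
Proof.
move=> n0; have tb k := kernel_tail_bounds k n0.
rewrite sumr_ge0/= => [|k _]; last by have /andP[] := tb k.
have : \sum_(k < M) kernel_tail n (n.+1 + k)%:R <=
    kernel n n.+1%:R ^+ 2 * (6 * (1 - M.+1%:R^-1)) :> R.
  elim: M => [|M IH]; first by rewrite big_ord0 invr1 subrr !mulr0.
  rewrite big_ord_recr/=; have /andP[_ u] := tb M.
  apply: (le_trans (lerD IH u)); rewrite -mulrDr ler_wpM2l ?sqr_ge0//.
  rewrite le_eqVlt; apply/orP; left; apply/eqP.
  have M0 : 0 <= M%:R :> R by [].
  rewrite natrM !natrD -[M.+2%:R]natr1 -[M.+1%:R]natr1.
  by field; rewrite !gt_eqF//; lra.
move/le_trans; apply; rewrite mulrC ler_wpM2r ?sqr_ge0//.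
by rewrite ler_piMr// gerBl invr_ge0.
Qed.

(** * Summing the tails *)

(** From n = 1 on the sequence decreases and is nonnegative, both because
    ln (1 + t) <= t; so the limit defining Euler's constant exists. *)
Lemma cvg_euler_gamma :
  (fun N : nat => H N - ln N%:R) @ \oo --> euler_gamma R.
Proof.
suff : cvgn (fun N : nat => H N - ln N%:R) by [].
have ln_lb N : ln N.+1%:R <= H N.
  elim: N => [|N IH]; first by rewrite ln1 /harmonic_number big_geq.
  rewrite harmonic_numberS -lerBlDl; apply: le_trans (lerB (lexx _) IH) _.
  rewrite -ln_div ?posrE// -[N.+2%:R]natr1 mulrDl divff ?mul1r ?pnatr_eq0//.
  by apply: le_ln1Dx; apply: lt_le_trans (_ : 0 <= _); rewrite ?ltrN10.
suff [l ul] : exists l, (fun N : nat => H (N + 1) - ln (N + 1)%:R) @ \oo --> (l : R).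
  by apply/cvg_ex; exists l; rewrite -(cvg_shiftn 1).
apply/cvg_ex/nonincreasing_is_cvgn.
  apply/nonincreasing_seqP => N; rewrite !addn1 (harmonic_numberS N.+1).
  have h : ln N.+1%:R - ln N.+2%:R <= - N.+2%:R^-1 :> R.
    rewrite -ln_div ?posrE//.
    have -> : N.+1%:R / N.+2%:R = 1 - N.+2%:R^-1 :> R.
      by rewrite -[N.+1%:R](addrK 1) natr1 mulrBl divff ?mul1r ?pnatr_eq0.
    by apply: le_ln1Dx; rewrite ltrN2 invf_lt1// ltr1n.
  rewrite -addrA lerD2l lerBlDr -lerN2 opprD opprK; exact: h.
exists 0 => _ [N _ <-]; rewrite addn1 subr_ge0 (le_trans (ln_lb N))//.
by rewrite harmonic_numberS lerDl.
Qed.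

Lemma A_E n : A_ R n = \sum_(k < n.+1) sqbin n k * H (n + k).
Proof. by rewrite /A_ big_mkord. Qed.

Lemma harmonic_numberB a b : (a <= b)%N ->
  H b - H a = \sum_(a.+1 <= j < b.+1) j%:R^-1.
Proof.
move=> ab; rewrite /harmonic_number (big_cat_nat (n := a.+1))//=.
by rewrite addrAC subrr add0r.
Qed.

(** The terms left out on either side cancel by antisymmetry.  This accounts
    for the minimum in the range of the inner sum of [L_]. *)
Lemma sum_logcoef_prefix n k : (k <= n.+1)%N ->
  \sum_(i < k) logcoef n i = \sum_(i < n.+1 - k) logcoef n i.
Proof.
move=> kn; have /eqP := sum_logcoef n.
rewrite -!(big_mkord predT (logcoef n)) (big_cat_nat (n := k))//= addr_eq0.
move=> /eqP ->; rewrite -{1}(add0n k) big_addn big_nat_rev/= -sumrN.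
apply: eq_big_nat => i /andP[_ ik].
rewrite -logcoef_rev; last lia.
congr (logcoef _ _); lia.
Qed.

Lemma L_prefix n : L_ R n =
  \sum_(m < n) (\sum_(i < m.+1) logcoef n i) * ln (n + m).+1%:R.
Proof.
rewrite /L_ big_add1/= big_mkord; apply: eq_bigr => m _.
have mn := ltn_ord m; rewrite addnS subn1/=.
have -> : \sum_(i < m.+1) logcoef n i =
    \sum_(0 <= i < (minn m (n - m.+1)).+1) logcoef n i.
  rewrite big_mkord; have [le_m|lt_m] := leqP m (n - m.+1); first by [].
  rewrite sum_logcoef_prefix; last lia.
  by rewrite (_ : n.+1 - m.+1 = (n - m.+1).+1)%N//; lia.
rewrite mulr_suml; apply: eq_big_nat => i /andP[_ im].
rewrite /logcoef harmonic_numberB; last lia.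
rewrite mulr_sumr mulr_suml; apply: eq_bigr => j _; ring.
Qed.

Lemma ln_factS n : ln n.+1`!%:R = ln n`!%:R + ln n.+1%:R :> R.
Proof. by rewrite factS natrM lnM ?posrE ?ltr0n ?fact_gt0// addrC. Qed.

Lemma ln_factD n k :
  ln (n + k)`!%:R = ln n`!%:R + \sum_(i < k) ln (n + i).+1%:R :> R.
Proof.
elim: k => [|k IH]; first by rewrite big_ord0 addn0 addr0.
by rewrite addnS ln_factS IH big_ord_recr/= addrA.
Qed.

(** Abel summation of [L_prefix]; the boundary term vanishes with the sum of
    the [logcoef n k]. *)
Lemma L_E n : L_ R n = - \sum_(k < n.+1) logcoef n k * ln (n + k)`!%:R.
Proof.
apply/eqP; rewrite -addr_eq0 addrC; apply/eqP.
under eq_bigr do rewrite ln_factD mulrDr.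
rewrite big_split/= -mulr_suml sum_logcoef mul0r add0r L_prefix.
by rewrite (abel_summation _ (fun m => ln (n + m).+1%:R)) sum_logcoef mul0r.
Qed.

Lemma sum_kernel_tailE n M : \sum_(v < M) kernel_tail n (n.+1 + v)%:R =
  \sum_(k < n.+1) (sqbin n k * (H (n + M + k) - H (n + k)) +
     logcoef n k * (ln (n + M + k)`!%:R - ln (n + k)`!%:R)) :> R.
Proof.
elim: M => [|M IH].
  by rewrite big_ord0 addn0 big1// => k _; rewrite !subrr !mulr0 addr0.
rewrite big_ord_recr/= IH -big_split/=; apply: eq_bigr => k _.
rewrite -natrD addnS addSn harmonic_numberS ln_factS; ring.
Qed.

(** In [sum_kernel_tailE], set N = n + M.  Each H (N + k) is Euler's constant
    plus ln (N + k) plus o(1), and ln (N + k)! is ln N! + k ln N + o(1).  The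
    total coefficients of ln N! and of ln N are [sum_logcoef] and
    [sum_sqbin] + [sum_mul_logcoef], that is, 0. *)
Lemma cvg_sum_kernel_tail n : (0 < n)%N ->
  (fun M : nat => \sum_(v < M) kernel_tail n (n.+1 + v)%:R) @ \oo -->
  'C(2 * n, n)%:R * euler_gamma R + L_ R n - A_ R n.
Proof.
move=> n0.
pose d k (N : nat) : R := ln (N + k)%:R - ln N%:R.
pose g N := \sum_(k < n.+1) (sqbin n k * (H (N + k) - ln (N + k)%:R) +
  (sqbin n k * d k N + logcoef n k * \sum_(i < k) d i.+1 N)) + L_ R n - A_ R n.
have -> : (fun M : nat => \sum_(v < M) kernel_tail n (n.+1 + v)%:R) =
    (fun M : nat => g (M + n)%N).
  apply/funext => M; rewrite sum_kernel_tailE addnC /g L_E A_E.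
  rewrite -!sumrN -!big_split/=.
  move: (M + n)%N => N; apply/eqP; rewrite -subr_eq0 -sumrB; apply/eqP.
  transitivity (\sum_(k < n.+1) (logcoef n k * ln N`!%:R +
      (sqbin n k + k%:R * logcoef n k) * ln N%:R)).
    apply: eq_bigr => k _; rewrite ln_factD.
    have -> : \sum_(i < k) d i.+1 N = \sum_(i < k) ln (N + i).+1%:R - k%:R * ln N%:R.
      rewrite sumrB sumr_const card_ord mulr_natl; congr (_ - _).
      by apply: eq_bigr => i _; rewrite addnS.
    rewrite /d; ring.
  rewrite big_split/= -!mulr_suml sum_logcoef mul0r add0r.
  by rewrite big_split/= sum_mul_logcoef// sum_sqbin subrr mul0r.
rewrite (cvg_shiftn n g) /g.
apply: cvgB; last exact: cvg_cst.
apply: cvgD; last exact: cvg_cst.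
rewrite -sum_sqbin mulr_suml; apply: cvg_big => [|k _]; first exact: add_continuous.
rewrite -[X in _ --> X]addr0; apply: cvgD.
  apply: cvgMl_tmp; have := cvg_euler_gamma.
  by rewrite -(cvg_shiftn k).
rewrite -[X in _ --> X](addr0 0); apply: cvgD.
  rewrite -[X in _ --> X](mulr0 (sqbin n k)); apply: cvgMl_tmp.
  exact: cvg_ln_shift.
rewrite -[X in _ --> X](mulr0 (logcoef n k)); apply: cvgMl_tmp.
rewrite [X in _ --> X](_ : 0 = \sum_(i < k) (0 : R)); last by rewrite big1.
apply: cvg_big => [|i _]; first exact: add_continuous.
exact: cvg_ln_shift.
Qed.

Lemma kernel_at_succ n :
  kernel n n.+1%:R = ((2 * n).+1%:R * 'C(2 * n, n)%:R)^-1 :> R.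
Proof.
have e m : n`!%:R * \prod_(k < m) (n.+1%:R + k%:R) = (n + m)`!%:R :> R.
  elim: m => [|m IH]; first by rewrite big_ord0 mulr1 addn0.
  by rewrite big_ord_recr/= mulrA IH -natrD -natrM mulnC addnS factS.
have f0 m : m`!%:R != 0 :> R by rewrite pnatr_eq0 -lt0n fact_gt0.
have := e n.+1; rewrite addnS addnn -mul2n factS.
have := bin_fact (leq_addr n n); rewrite addKn addnn -mul2n => <-.
rewrite !natrM /kernel; move: (f0 n) => {}f0 e1.
have -> : \prod_(k < n.+1) (n.+1%:R + k%:R) =
    (2 * n).+1%:R * 'C(2 * n, n)%:R * n`!%:R :> R.
  by apply: (mulfI f0); rewrite e1; ring.
by rewrite [X in _ / X]mulrC invfM mulrA divff ?mul1r.
Qed.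

Lemma euler_gamma_bounds n : (0 < n)%N ->
  0 <= 'C(2 * n, n)%:R * euler_gamma R + L_ R n - A_ R n <=
    6 / ((2 * n).+1%:R * 'C(2 * n, n)%:R) ^+ 2.
Proof.
move=> n0; have c := cvg_sum_kernel_tail n0.
have b M := sum_kernel_tail_bounds M n0.
rewrite -exprVn -kernel_at_succ.
apply/andP; split.
  by apply: (cvgr_to_ge c); near=> M; have /andP[] := b M.
by apply: (cvgr_to_le c); near=> M; have /andP[] := b M.
Unshelve. all: by end_near. Qed.

End SondowSeries.

(** * The rate of approximation *)

Theorem theorem9 (R : realType) :
  (fun _ : nat => euler_gamma R) =
    (fun n : nat => (A_ R n - L_ R n) / ('C(2 * n, n))%:R)
    +O_ \oo (fun n : nat => 2 ^- (6 * n) * n%:R `^ (- (1 / 2)) : R).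
Proof.
apply/eqaddOP; near=> K; near=> n.
have n0 : (0 < n)%N by near: n; exists 1%N.
have /andP[lo hi] := euler_gamma_bounds R n0.
set c := 'C(2 * n, n)%:R : R in lo hi *.
have c0 : 0 < c by rewrite ltr0n bin_gt0; lia.
(* In terms of s = sqrt n and q = 4^n, the bounds are polynomial in s, q, c. *)
pose s := Num.sqrt n%:R : R.
have s0 : 0 < s by rewrite sqrtr_gt0 ltr0n.
have s2 : s ^+ 2 = n%:R by rewrite sqr_sqrtr.
pose q : R := 4 ^+ n.
have q0 : 0 < q by rewrite exprn_gt0.
have [c_ge0 s_ge0 q_ge0] : [/\ 0 <= c, 0 <= s & 0 <= q] by split; exact: ltW.
have qle : q <= 2 * s * c.
  rewrite -ler_sqr ?nnegrE ?mulr_ge0// !exprMn s2.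
  have := central_binomial_lb n0; rewrite -(ler_nat R).
  rewrite natrX (natrM _ (4 * n)) (natrM _ 4) natrX -/c.
  have e16 : 4 ^+ 2 = 16 :> R by ring.
  have e4 : 2 ^+ 2 = 4 :> R by ring.
  by rewrite /q exprAC e16 e4.
rewrite [_ `^ _]powRN div1r powR12_sqrt// -/s.
have -> : 2 ^- (6 * n) = (q ^+ 3)^-1 :> R.
  rewrite /q -exprM (_ : 6 * n = 2 * (n * 3))%N; last by lia.
  by rewrite (exprM 2); congr (_ ^+ _)^-1; ring.
rewrite [`|_ / s|]ger0_norm; last by rewrite divr_ge0 ?invr_ge0 ?exprn_ge0.
have -> : ((fun=> euler_gamma R) - (fun n : nat => (A_ R n - L_ R n) / 'C(2 * n, n)%:R)) n
    = (c * euler_gamma R + L_ R n - A_ R n) / c.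
  rewrite !fctE -/c; field; exact: lt0r_neq0.
rewrite ger0_norm; last by rewrite divr_ge0.
have K12 : 12 <= K by near: K; exact: nbhs_pinfty_ge.
apply: (@le_trans _ _ (12 * (q ^- 3 / s))); last first.
  by rewrite ler_wpM2r// divr_ge0 ?invr_ge0 ?exprn_ge0.
rewrite ler_pdivrMr//; apply: (le_trans hi).
rewrite -[(2 * n).+1%:R]natr1 natrM -s2.
have -> : 12 * (q ^- 3 / s) * c = 12 * c / s / q ^+ 3.
  by field; rewrite !lt0r_neq0.
rewrite ler_pdivrMr; last by rewrite exprn_gt0// mulr_gt0// ltr_wpDl// mulr_ge0 ?exprn_ge0.
rewrite mulrAC ler_pdivlMr ?exprn_gt0// mulrAC ler_pdivlMr// mulrAC.
have q3 : q ^+ 3 <= (2 * s * c) ^+ 3 by rewrite lerXn2r ?nnegrE ?mulr_ge0.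
apply: (@le_trans _ _ (6 * s * (2 * s * c) ^+ 3)); first by rewrite ler_wpM2l ?mulr_ge0.
have -> : 6 * s * (2 * s * c) ^+ 3 = 12 * (2 * s ^+ 2) ^+ 2 * c ^+ 3 by ring.
have -> : 12 * c * ((2 * s ^+ 2 + 1) * c) ^+ 2 = 12 * (2 * s ^+ 2 + 1) ^+ 2 * c ^+ 3 by ring.
rewrite ler_wpM2r ?exprn_ge0// ler_wpM2l// ler_sqr ?nnegrE ?lerDl//.
  by rewrite mulr_ge0 ?exprn_ge0.
by rewrite addr_ge0// mulr_ge0 ?exprn_ge0.
Unshelve. all: by end_near. Qed.
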